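(* Let $\Lambda$ be any $3$-graph. Define directed graphs $$G(\Lambda):=(\Lambda^{\mathbf e_1+\mathbf e_2},\Lambda^{\mathbf e_1+\mathbf e_2+\mathbf e_3},\mathrm{ev}_{\mathbf e_3,\mathbf e_1+\mathbf e_2+\mathbf e_3},\mathrm{ev}_{0,\mathbf e_1+\mathbf e_2}),$$ $$F_1(\Lambda):=(\Lambda^{\mathbf e_2},\Lambda^{\mathbf e_2+\mathbf e_3},\mathrm{ev}_{\mathbf e_3,\mathbf e_2+\mathbf e_3},\mathrm{ev}_{0,\mathbf e_2}),\quad F_2(\Lambda):=(\Lambda^{\mathbf e_1},\Lambda^{\mathbf e_1+\mathbf e_3},\mathrm{ev}_{\mathbf e_3,\mathbf e_1+\mathbf e_3},\mathrm{ev}_{0,\mathbf e_1}),$$ $$E(\Lambda):=(\Lambda^0,\Lambda^{\mathbf e_3},s_\Lambda,r_\Lambda),$$ and (vertex map, edge map) pairs $p_1,q_1:G(\Lambda)\to F_1(\Lambda)$, $p_2,q_2:G(\Lambda)\to F_2(\Lambda)$, $g_1,h_1:F_1(\Lambda)\to E(\Lambda)$, $g_2,h_2:F_2(\Lambda)\to E(\Lambda)$ by $$p_1:=(\mathrm{ev}_{0,\mathbf e_2},\mathrm{ev}_{0,\mathbf e_2+\mathbf e_3}),\quad q_1:=(\mathrm{ev}_{\mathbf e_1,\mathbf e_1+\mathbf e_2},\mathrm{ev}_{\mathbf e_1,\mathbf e_1+\mathbf e_2+\mathbf e_3}),$$ $$p_2:=(\mathrm{ev}_{0,\mathbf e_1},\mathrm{ev}_{0,\mathbf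 e_1+\mathbf e_3}),\quad q_2:=(\mathrm{ev}_{\mathbf e_2,\mathbf e_1+\mathbf e_2},\mathrm{ev}_{\mathbf e_2,\mathbf e_1+\mathbf e_2+\mathbf e_3}),$$ $$g_1:=(r_\Lambda,\mathrm{ev}_{0,\mathbf e_3}),\quad h_1:=(s_\Lambda,\mathrm{ev}_{\mathbf e_2,\mathbf e_2+\mathbf e_3}),\quad g_2:=(r_\Lambda,\mathrm{ev}_{0,\mathbf e_3}),\quad h_2:=(s_\Lambda,\mathrm{ev}_{\mathbf e_1,\mathbf e_1+\mathbf e_3}).$$ Then the system $\mathcal{T}_\Lambda$ consisting of these graphs and maps is a three-dimensional textile system.
   Context: A $k$-graph is a small category $\Lambda$ (codomain map $r_\Lambda$, domain map $s_\Lambda$; $\alpha\beta$ is defined when $s_\Lambda(\alpha)=r_\Lambda(\beta)$) with a functor $d:\Lambda\to\mathbb{N}^k$ ($\mathbb{N}$ includes $0$) satisfying unique factorization: if $d(\lambda)=\mathbf n+\mathbf m$ there are unique $\alpha,\beta$ with $d(\alpha)=\mathbf n$, $d(\beta)=\mathbf m$, $\lambda=\alpha\beta$. $\Lambda^{\mathbf n}:=d^{-1}(\mathbf n)$; $\Lambda^0$ is identified with the objects. For $0\le\mathbf n\le\mathbf m\le d(\lambda)$, $\lambda(\mathbf n,\mathbf m)$ is the unique element with $\lambda=\alpha\,\lambda(\mathbf n,\mathbf m)\,\beta$, $d(\alpha)=\mathbf n$, $d(\beta)=d(\lambda)-\mathbf m$; and $\mathrm{ev}_{\mathbf n,\mathbf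 m}(\lambda):=\lambda(\mathbf n,\mathbf m)\in\Lambda^{\mathbf m-\mathbf n}$ for $\mathbf n<\mathbf m\leq d(\lambda)$. $\mathbf e_i$ are the canonical basis vectors. A directed graph is written $E=(E^0,E^1,r_E,s_E)$: vertices, edges, range map, source map, in this order. A graph homomorphism $f=(f^0,f^1)$ consists of a vertex map and an edge map commuting with ranges and sources. A three-dimensional textile system consists of directed graphs $G,F_1,F_2,E$ and graph homomorphisms $p_1,q_1:G\to F_1$, $p_2,q_2:G\to F_2$, $g_1,h_1:F_1\to E$, $g_2,h_2:F_2\to E$ such that ($\mathcal C$) $g_1p_1=g_2p_2$, $h_1q_1=h_2q_2$, $g_1q_1=h_2p_2$, $h_1p_1=g_2q_2$; and ($\mathcal I$) the following maps are injective: $s_G\times r_G\times p_1^1\times q_1^1\times p_2^1\times q_2^1$ on $G^1$; $p_1^0\times q_1^0\times p_2^0\times q_2^0$ on $G^0$; $s_{F_1}\times r_{F_1}\times g_1^1\times h_1^1$ on $F_1^1$; $s_{F_2}\times r_{F_2}\times g_2^1\times h_2^1$ on $F_2^1$ (each map sends an element to the tuple of its images). *)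

(* Defs.v *)
From mathcomp Require Import all_boot all_order all_algebra.
From mathcomp Require Import mpoly.
From Stdlib Require Import ClassicalEpsilon.

Set Implicit Arguments.
Unset Strict Implicit.
Unset Printing Implicit Defensive.

(* The monoid N^k is the type 'X_{1..k} of multinomials: pointwise addition and
   truncated subtraction, canonical basis U_(i), and (n <= m)%MM the
   coordinatewise order (whereas (n <= m)%O is a monomial order). *)

(* [comp a b] is the composite "ab"; it is meaningful only if
   [src a = rng b], and its value is unconstrained otherwise. *)
Record category := Category {
  obj : Type;
  mor : Type;
  rng : mor -> obj;
  src : mor -> obj;
  idm : obj -> mor;
  comp : mor -> mor -> mor;
  rng_id : forall v, rng (idm v) = v;
  src_id : forall v, src (idm v) = v;
  rng_comp : forall a b, src a = rng b -> rng (comp a b) = rng a;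
  src_comp : forall a b, src a = rng b -> src (comp a b) = src b;
  comp_idl : forall a, comp (idm (rng a)) a = a;
  comp_idr : forall a, comp a (idm (src a)) = a;
  compA : forall a b c, src a = rng b -> src b = rng c ->
    comp a (comp b c) = comp (comp a b) c }.

Record kgraph (k : nat) := KGraph {
  kcat :> category;
  deg : mor kcat -> 'X_{1..k};
  deg_id : forall v, deg (idm v) = 0%MM;
  deg_comp : forall a b, src a = rng b -> deg (comp a b) = (deg a + deg b)%MM;
  factorization : forall (l : mor kcat) (n m : 'X_{1..k}),
    deg l = (n + m)%MM ->
    exists! ab : mor kcat * mor kcat,
      [/\ deg ab.1 = n, deg ab.2 = m, src ab.1 = rng ab.2
        & l = comp ab.1 ab.2] }.

Section KGraph.
Variables (k : nat) (L : kgraph k).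
Implicit Types (l n m p : 'X_{1..k}) (v : obj L).

Definition level n : Type := {a : mor L | deg a == n}.

(* The identification of objects with elements of degree 0; it is justified by
   [vertex_bij] below. *)
Definition vertex v : level 0%MM :=
  exist _ (idm v) (introT eqP (deg_id v)).

Definition rngL l (a : level l) : level 0%MM := vertex (rng (sval a)).
Definition srcL l (a : level l) : level 0%MM := vertex (src (sval a)).

Lemma vertex_bij : bijective vertex.
Proof.
exists (fun a => rng (sval a)) => [v | [a a0]]; first exact: rng_id.
apply: val_inj => /=; move/eqP: a0 => a0.
have E : deg a = (0 + 0)%MM by rewrite a0 addm0.
have [ab [_ U]] := factorization E.
have := U (idm (rng a), a); rewrite /= deg_id src_id comp_idl.
have := U (a, idm (src a)); rewrite /= deg_id rng_id comp_idr.
by move=> /(_ (And4 a0 erefl erefl erefl)) ->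
  /(_ (And4 erefl a0 erefl erefl)) [].
Qed.

Definition is_segment (a : mor L) n m (s : mor L) : Prop :=
  exists x y : mor L,
    [/\ deg x = n, deg y = (deg a - m)%MM, src x = rng s, src s = rng y
      & a = comp (comp x s) y].

Lemma is_segment_deg a n m s : (n <= m)%MM -> (m <= deg a)%MM ->
  is_segment a n m s -> deg s = (m - n)%MM.
Proof.
move=> nm ma [x [y [dx dy xs sy Ea]]].
have : deg a = (n + deg s + (deg a - m))%MM.
  by rewrite {1}Ea deg_comp ?src_comp // deg_comp // dx dy.
move=> /mnmP E; apply/mnmP => i; have := E i; rewrite !(mnmDE, mnmBE).
move/mnm_lepP: nm => /(_ i) nm; move/mnm_lepP: ma => /(_ i) ma.
rewrite -{1}(subnK ma) addnC => /eqP; rewrite eqn_add2r => /eqP ->.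
by rewrite addKn.
Qed.

Lemma segment_ex_unique a n m : (n <= m)%MM -> (m <= deg a)%MM ->
  exists! s, is_segment a n m s.
Proof.
move=> nm ma.
have Ea : deg a = (m + (deg a - m))%MM by rewrite addmC submK.
have [[t y] [/= [dt dy ty aE] U1]] := factorization Ea.
have Et : deg t = (n + (m - n))%MM by rewrite dt addmC submK.
have [[x s] [/= [dx ds xs tE] U2]] := factorization Et.
exists s; split.
  by exists x, y; split=> //; rewrite -?tE // -ty tE src_comp.
move=> s' s's; have ds' := is_segment_deg nm ma s's.
case: s's => x' [y' [dx' dy' xs' sy' aE']].
have /U1 [tE' _] : [/\ deg (comp x' s', y').1 = m,
    deg (comp x' s', y').2 = (deg a - m)%MM,
    src (comp x' s', y').1 = rng (comp x' s', y').2
    & a = comp (comp x' s', y').1 (comp x' s', y').2].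
  by split=> //=; rewrite ?src_comp // deg_comp // dx' ds' addmC submK.
have /U2 [] // : [/\ deg (x', s').1 = n, deg (x', s').2 = (m - n)%MM,
    src (x', s').1 = rng (x', s').2 & t = comp (x', s').1 (x', s').2].
by split.
Qed.

Definition segment (a : mor L) n m (nm : (n <= m)%MM) (ma : (m <= deg a)%MM) :
    mor L :=
  proj1_sig (constructive_definite_description _ (segment_ex_unique nm ma)).

Lemma segmentP a n m (nm : (n <= m)%MM) (ma : (m <= deg a)%MM) :
  is_segment a n m (segment nm ma).
Proof. by rewrite /segment; case: constructive_definite_description. Qed.

Definition ev_bounds l p n m := [&& (n <= m)%MM, (m <= l)%MM & p == (m - n)%MM].

Fact ev_le l p n m : ev_bounds l p n m -> (n <= m)%MM.
Proof. by case/and3P. Qed.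

Fact ev_le_deg l p n m : ev_bounds l p n m ->
  forall a : level l, (m <= deg (sval a))%MM.
Proof. by case/and3P=> _ ml _ [a /= /eqP ->]. Qed.

Fact ev_deg l p n m (b : ev_bounds l p n m) (a : level l) :
  deg (segment (ev_le b) (ev_le_deg b a)) == p.
Proof.
have /and3P[_ _ /eqP pE] := b; apply/eqP; apply: etrans (esym pE).
exact: is_segment_deg (ev_le b) (ev_le_deg b a) (segmentP _ _).
Qed.

(* The codomain [level p] is a parameter, with [p = m - n] a hypothesis, because
   e.g. [e1 + e2 + e3 - e3] and [e1 + e2] are not convertible. *)
Definition ev l p n m (b : ev_bounds l p n m) (a : level l) : level p :=
  exist _ (segment (ev_le b) (ev_le_deg b a)) (ev_deg b a).

End KGraph.

Arguments ev {k L l p} n m & b a.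

Record digraph := Digraph {
  vert : Type;
  edge : Type;
  erng : edge -> vert;
  esrc : edge -> vert }.

Record gmap (A B : digraph) := GMap {
  vmap : vert A -> vert B;
  emap : edge A -> edge B }.

Definition is_hom (A B : digraph) (f : gmap A B) : Prop :=
  (forall x, erng (emap f x) = vmap f (erng x)) /\
  (forall x, esrc (emap f x) = vmap f (esrc x)).

Definition gcomp (A B C : digraph) (g : gmap B C) (f : gmap A B) : gmap A C :=
  GMap (vmap g \o vmap f) (emap g \o emap f).

Definition eq_gmap (A B : digraph) (f g : gmap A B) : Prop :=
  vmap f =1 vmap g /\ emap f =1 emap g.

Record textile_data := TextileData {
  tG : digraph; tF1 : digraph; tF2 : digraph; tE : digraph;
  p1 : gmap tG tF1; q1 : gmap tG tF1;
  p2 : gmap tG tF2; q2 : gmap tG tF2;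
  g1 : gmap tF1 tE; h1 : gmap tF1 tE;
  g2 : gmap tF2 tE; h2 : gmap tF2 tE }.

Record is_textile_system (T : textile_data) : Prop := IsTextileSystem {
  p1_hom : is_hom (p1 T); q1_hom : is_hom (q1 T);
  p2_hom : is_hom (p2 T); q2_hom : is_hom (q2 T);
  g1_hom : is_hom (g1 T); h1_hom : is_hom (h1 T);
  g2_hom : is_hom (g2 T); h2_hom : is_hom (h2 T);
  commut_gp : eq_gmap (gcomp (g1 T) (p1 T)) (gcomp (g2 T) (p2 T));
  commut_hq : eq_gmap (gcomp (h1 T) (q1 T)) (gcomp (h2 T) (q2 T));
  commut_gq : eq_gmap (gcomp (g1 T) (q1 T)) (gcomp (h2 T) (p2 T));
  commut_hp : eq_gmap (gcomp (h1 T) (p1 T)) (gcomp (g2 T) (q2 T));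
  inj_G1 : injective (fun x : edge (tG T) =>
    (esrc x, erng x, emap (p1 T) x, emap (q1 T) x,
     emap (p2 T) x, emap (q2 T) x));
  inj_G0 : injective (fun v : vert (tG T) =>
    (vmap (p1 T) v, vmap (q1 T) v, vmap (p2 T) v, vmap (q2 T) v));
  inj_F1 : injective (fun x : edge (tF1 T) =>
    (esrc x, erng x, emap (g1 T) x, emap (h1 T) x));
  inj_F2 : injective (fun x : edge (tF2 T) =>
    (esrc x, erng x, emap (g2 T) x, emap (h2 T) x)) }.

Definition e1 : 'X_{1..3} := U_(@Ordinal 3 0 isT)%MM.
Definition e2 : 'X_{1..3} := U_(@Ordinal 3 1 isT)%MM.
Definition e3 : 'X_{1..3} := U_(@Ordinal 3 2 isT)%MM.

Local Ltac solve_ev_bounds :=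
  rewrite /e1 /e2 /e3; apply/and3P; split;
  [ apply/mnm_lepP | apply/mnm_lepP | apply/eqP/mnmP ];
  by (case=> [[|[|[|?]]] ?]; rewrite ?mnmBE ?mnmDE ?mnm1E ?mnm0E).

#[local] Obligation Tactic := solve_ev_bounds.

Section TextileOfKGraph.
Variable L : kgraph 3.
Local Open Scope multi_scope.

Program Definition GL : digraph :=
  @Digraph (level L (e1 + e2)) (level L (e1 + e2 + e3))
    (ev e3 (e1 + e2 + e3) _) (ev 0 (e1 + e2) _).

Program Definition F1L : digraph :=
  @Digraph (level L e2) (level L (e2 + e3))
    (ev e3 (e2 + e3) _) (ev 0 e2 _).

Program Definition F2L : digraph :=
  @Digraph (level L e1) (level L (e1 + e3))
    (ev e3 (e1 + e3) _) (ev 0 e1 _).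

Definition EL : digraph :=
  @Digraph (level L 0) (level L e3) (@srcL _ L e3) (@rngL _ L e3).

Program Definition p1L : gmap GL F1L :=
  @GMap GL F1L (ev 0 e2 _) (ev 0 (e2 + e3) _).
Program Definition q1L : gmap GL F1L :=
  @GMap GL F1L (ev e1 (e1 + e2) _) (ev e1 (e1 + e2 + e3) _).
Program Definition p2L : gmap GL F2L :=
  @GMap GL F2L (ev 0 e1 _) (ev 0 (e1 + e3) _).
Program Definition q2L : gmap GL F2L :=
  @GMap GL F2L (ev e2 (e1 + e2) _) (ev e2 (e1 + e2 + e3) _).
Program Definition g1L : gmap F1L EL := @GMap F1L EL (@rngL _ L e2) (ev 0 e3 _).
Program Definition h1L : gmap F1L EL :=
  @GMap F1L EL (@srcL _ L e2) (ev e2 (e2 + e3) _).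
Program Definition g2L : gmap F2L EL := @GMap F2L EL (@rngL _ L e1) (ev 0 e3 _).
Program Definition h2L : gmap F2L EL :=
  @GMap F2L EL (@srcL _ L e1) (ev e1 (e1 + e3) _).

Definition textileL : textile_data :=
  TextileData p1L q1L p2L q2L g1L h1L g2L h2L.

End TextileOfKGraph.

(* Main.v *)
(* A segment of a morphism is determined by its two endpoints, and the segment
   of a segment is a segment: l(n,m)(n',m') = l(n+n',n+m').  Identifying
   objects with degenerate segments l(n,n), each homomorphism condition and each
   equation in (C) says that two segments of the same morphism have the same
   endpoints.  For (I), a morphism is recovered from an initial and a final
   segment which together cover it. *)
From mathcomp Require Import all_boot.
From mathcomp Require Import mpoly.
Require Import Defs.

Set Implicit Arguments.
Unset Strict Implicit.
Unset Printing Implicit Defensive.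

Section Segments.
Variables (k : nat) (L : kgraph k).
Implicit Types (a b s t x y : mor L) (l n m p : 'X_{1..k}).

Lemma deg0_idm a : deg a = 0%MM -> exists v, a = idm v.
Proof.
move=> a0; have [g _ gK] := vertex_bij L.
pose u : level L 0%MM := exist _ a (introT eqP a0).
by exists (g u); have /= -> := congr1 sval (gK u).
Qed.

Lemma comp_deg0l a b : src a = rng b -> deg a = 0%MM -> comp a b = b.
Proof.
move=> ab /deg0_idm[v aE]; move: ab.
by rewrite aE src_id => ->; exact: comp_idl.
Qed.

Lemma comp_deg0r a b : src a = rng b -> deg b = 0%MM -> comp a b = a.
Proof.
move=> ab /deg0_idm[v bE]; move: ab.
by rewrite bE rng_id => <-; exact: comp_idr.
Qed.

(** Addition in N^k cancels, so the right factors have equal degrees too, and unique factorization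
    applies to the common composite. *)
Lemma comp_inj_degl a b s t :
  src a = rng b -> src s = rng t -> deg a = deg s -> comp a b = comp s t ->
  (a, b) = (s, t).
Proof.
move=> ab st das E.
have dbt : deg b = deg t.
  by apply: (@addmI _ (deg a)); rewrite {2}das -!deg_comp // E.
have [u [_ U]] := factorization (deg_comp ab).
by rewrite -(U (a, b)) // -(U (s, t)).
Qed.

Lemma comp_inj_degr a b s t :
  src a = rng b -> src s = rng t -> deg b = deg t -> comp a b = comp s t ->
  (a, b) = (s, t).
Proof.
move=> ab st dbt E; apply: comp_inj_degl => //.
apply: (@addmI _ (deg b)); rewrite addmC -deg_comp // E.
by rewrite deg_comp // dbt addmC.
Qed.

Lemma is_segment_unique a n m s t :
  is_segment a n m s -> is_segment a n m t -> s = t.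
Proof.
move=> [x [y [dx dy xs sy Es]]] [x' [y' [dx' dy' xt ty' Et]]].
have [xsE _] : (comp x s, y) = (comp x' t, y').
  by apply: comp_inj_degr; rewrite ?src_comp -?Es ?dy.
by have [_ ->] : (x, s) = (x', t) by apply: comp_inj_degl; rewrite ?dx.
Qed.

Lemma is_segment_trans a n m s n' m' t : (m' <= deg s)%MM ->
  is_segment a n m s -> is_segment s n' m' t ->
  is_segment a (n + n')%MM (n + m')%MM t.
Proof.
move=> m's [x [y [dx dy xs sy Ea]]] [x' [y' [dx' dy' x't ty' Es]]].
have rs : rng s = rng x' by rewrite Es !rng_comp ?src_comp.
have ss : src s = src y' by rewrite Es !src_comp ?src_comp.
exists (comp x x'), (comp y' y).
rewrite !deg_comp ?src_comp ?rng_comp -?rs -?ss //; split=> //.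
- by rewrite dx dx'.
- have -> : deg a = (n + deg s + deg y)%MM.
    by rewrite Ea !deg_comp ?src_comp // dx.
  (* Subtraction is truncated: moving [deg y] across [deg s - m'] relies on [m' <= deg s]. *)
  rewrite dy'; apply/mnmP => i; move/mnm_lepP: m's => /(_ i) m's.
  by rewrite !(mnmDE, mnmBE) -addnA subnDl addnBAC.
have xx' : src x = rng x' by rewrite -rs.
have y'y : src y' = rng y by rewrite -ss.
by rewrite Ea Es !compA ?src_comp ?rng_comp //.
Qed.

(** Regroup [a = x s y] as [x], an identity, and [s y]. *)
Lemma is_segment_rng a n m s :
  is_segment a n m s -> is_segment a n n (idm (rng s)).
Proof.
move=> [x [y [dx dy xs sy Ea]]].
exists x, (comp s y); rewrite rng_id src_id rng_comp //; split=> //.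
  (* The tail [s y] has degree [deg a - n], checked after adding [n = deg x], which is at most
     [deg a]. *)
  apply: (@addmI _ n); rewrite -{1}dx -deg_comp ?rng_comp // compA // -Ea.
  apply/mnmP => i; rewrite mnmDE mnmBE subnKC // Ea !deg_comp ?src_comp //.
  by rewrite !mnmDE dx -addnA leq_addr.
by rewrite -xs comp_idr Ea compA.
Qed.

Lemma is_segment_src a n m s : (m <= deg a)%MM ->
  is_segment a n m s -> is_segment a m m (idm (src s)).
Proof.
move=> ma [x [y [dx dy xs sy Ea]]].
exists (comp x s), y; rewrite rng_id src_id src_comp //; split=> //.
  apply: (@addmI _ (deg y)); rewrite addmC -deg_comp ?src_comp // -Ea dy.
  by rewrite submK.
by rewrite -[X in idm X](src_comp xs) comp_idr.
Qed.

(** Outer factors of degree 0 are identities, so [a = u (v y) = x' t] with [u] and [x'] both of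
    degree [n]; unique factorization gives [x' = u]. *)
Lemma comp_segments a n m u v t : deg u = n -> src u = rng v ->
  is_segment a 0%MM m (comp u v) -> is_segment a n (deg a) t -> a = comp u t.
Proof.
move=> du uv [x [y [dx dy xs sy Es]]] [x' [y' [dx' dy' xt ty' Et]]].
rewrite (comp_deg0l xs dx) in Es; rewrite src_comp // in sy.
have d0 : deg y' = 0%MM.
  by rewrite dy'; apply/mnmP => i; rewrite mnmBE mnm0E subnn.
rewrite comp_deg0r ?src_comp // in Et.
suff [-> _] : (u, comp v y) = (x', t) by [].
by apply: comp_inj_degl; rewrite ?rng_comp ?compA -?Es ?dx'.
Qed.

Lemma ev_segment l p n m (b : ev_bounds l p n m) (a : level L l) :
  is_segment (sval a) n m (sval (ev n m b a)).
Proof. exact: segmentP. Qed.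

(** As [n <= m], the shared initial segment factors as [s = u v] with [deg u = n], and both
    morphisms equal [u t]. *)
Lemma level_eq_of_segments l (a a' : level L l) n m (s t : mor L) :
  (n <= m)%MM -> (m <= l)%MM ->
  is_segment (sval a) 0%MM m s -> is_segment (sval a') 0%MM m s ->
  is_segment (sval a) n l t -> is_segment (sval a') n l t -> a = a'.
Proof.
case: a a' => [a /= da] [a' /= da'] nm ml as_ a's at_ a't; apply: val_inj => /=.
move/eqP: da => da; move/eqP: da' => da'.
have ds : deg s = (n + (m - n))%MM.
  rewrite (is_segment_deg _ _ as_) ?da //.
    by rewrite subm0 addmC submK.
  by apply/mnm_lepP => i; rewrite mnm0E.
have [[u v] [/= [du _ uv sE] _]] := factorization ds.
rewrite sE in as_ a's; rewrite -{1}da in at_; rewrite -da' in a't.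
rewrite (comp_segments du uv as_ at_).
by rewrite (comp_segments du uv a's a't).
Qed.

Lemma ev_cover_inj l p p' n m (b : ev_bounds l p 0%MM m)
    (b' : ev_bounds l p' n l) (a a' : level L l) : (n <= m)%MM ->
  sval (ev 0%MM m b a) = sval (ev 0%MM m b a') ->
  sval (ev n l b' a) = sval (ev n l b' a') -> a = a'.
Proof.
move=> nm E E'; have /and3P[_ ml _] := b.
apply: (level_eq_of_segments nm ml (ev_segment b a) _ (ev_segment b' a)).
  by rewrite E; apply: ev_segment.
by rewrite E'; apply: ev_segment.
Qed.

Lemma ev_ev_segment l p p' n m n' m' (b : ev_bounds l p n m)
    (b' : ev_bounds p p' n' m') (a : level L l) :
  is_segment (sval a) (n + n')%MM (n + m')%MM (sval (ev n' m' b' (ev n m b a))).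
Proof.
exact: is_segment_trans (ev_le_deg b' _) (ev_segment _ _) (ev_segment _ _).
Qed.

Lemma rngL_ev_segment l p n m (b : ev_bounds l p n m) (a : level L l) :
  is_segment (sval a) n n (sval (rngL (ev n m b a))).
Proof. exact: is_segment_rng (ev_segment b a). Qed.

Lemma srcL_ev_segment l p n m (b : ev_bounds l p n m) (a : level L l) :
  is_segment (sval a) m m (sval (srcL (ev n m b a))).
Proof. exact: is_segment_src (ev_le_deg b a) (ev_segment b a). Qed.

(** Endpoints such as [n + n'] agree only propositionally, so their equalities are separate
    premises. *)
Lemma is_segment_level l p (a : level L l) n m n' m' (s t : level L p) :
  is_segment (sval a) n m (sval s) -> is_segment (sval a) n' m' (sval t) ->
  n = n' -> m = m' -> s = t.
Proof.
move=> + + nE mE; rewrite -nE -mE => as_ at_; apply: val_inj.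
exact: is_segment_unique as_ at_.
Qed.

End Segments.

Local Ltac mnm3 :=
  rewrite /e1 /e2 /e3; first [apply/mnm_lepP | apply/mnmP];
  by (case=> [[|[|[|?]]] ?]; rewrite ?mnmBE ?mnmDE ?mnm1E ?mnm0E).

Local Ltac segment_of x :=
  first [exact: (rngL_ev_segment _ x) | exact: (srcL_ev_segment _ x)
        | exact: (ev_ev_segment _ _ x) | exact: (ev_segment _ x)].

Local Ltac same_segment :=
  let x := fresh "x" in move=> x /=;
  (* The endpoints stay open until the two segment goals determine them; they are then compared
     coordinatewise. *)
  eapply (@is_segment_level _ _ _ _ x);
    [segment_of x | segment_of x | mnm3 | mnm3].

Theorem proposition7p1 (L : kgraph 3) : is_textile_system (textileL L).
Proof.
split; try by split; same_segment.
(* On edges of G, [p2] gives the segment from 0 to [e1 + e3] and [q1] the one from [e1] to the end;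
   on vertices the two meet exactly at [e1]. *)
- by move=> x y [_ _ _ q1E p2E _]; apply: ev_cover_inj p2E q1E; mnm3.
- by move=> x y [_ q1E p2E _]; apply: ev_cover_inj p2E q1E; mnm3.
(* Here the source map supplies the initial segment, up to [e2] for F1 and [e1] for F2, where the
   final one begins. *)
- by move=> x y [sE _ _ h1E]; apply: ev_cover_inj sE h1E; mnm3.
- by move=> x y [sE _ _ h2E]; apply: ev_cover_inj sE h2E; mnm3.
Qed.
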